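(* Let $p$ be a prime number. Any perspective bounded Abelian $p$-group is finite.
   Context: An Abelian group $G$ is called perspective if any two isomorphic direct summands of $G$ have a common direct complement: whenever $G=A\oplus H=B\oplus K$ with $A\cong B$, there exists a subgroup $C\le G$ with $G=A\oplus C=B\oplus C$. A $p$-group $G$ is bounded if $p^nG=0$ for some integer $n\ge 0$. *)

(* Defs.v *)
From HB Require Import structures.
From mathcomp Require Import all_boot all_order all_algebra.
From mathcomp Require Import all_classical.

Set Implicit Arguments.
Unset Strict Implicit.
Unset Printing Implicit Defensive.

Import GRing.Theory.

Local Open Scope classical_set_scope.
Local Open Scope ring_scope.

(* Subgroups are [Prop]-valued sets; [ [in A] ] is the associated boolean
   predicate, on which the library's [zmod_closed] is stated. *)
Definition subgroup (G : zmodType) (A : set G) : Prop := zmod_closed [in A].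

(* The internal direct decomposition [G = A (+) H]. *)
Definition direct_sum (G : zmodType) (A H : set G) : Prop :=
  [/\ subgroup A, subgroup H, A `&` H = [set 0] &
      [set a + h | a in A & h in H] = [set: G]].

(* Isomorphism of the groups A and B. The values of [f] outside [A] are
   irrelevant: every map from A to B extends to a map on G. *)
Definition subgroup_iso (G : zmodType) (A B : set G) : Prop :=
  exists f : G -> G,
    {in A &, {morph f : x y / x + y}} /\ set_bij A B f.

Definition perspective (G : zmodType) : Prop :=
  forall A H B K : set G,
    direct_sum A H -> direct_sum B K -> subgroup_iso A B ->
    exists C : set G, direct_sum A C /\ direct_sum B C.

Definition abelian_pgroup (p : nat) (G : zmodType) : Prop :=
  forall x : G, exists k : nat, x *+ (p ^ k) = 0.

Definition bounded_pgroup (p : nat) (G : zmodType) : Prop :=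
  abelian_pgroup p G /\ exists n : nat, forall x : G, x *+ (p ^ n) = 0.

(* Main.v *)
Require Import Defs.
From HB Require Import structures.
From mathcomp Require Import all_boot all_order all_algebra.
From mathcomp Require Import all_classical.

Set Implicit Arguments.
Unset Strict Implicit.
Unset Printing Implicit Defensive.

Import Order.TTheory GRing.Theory Num.Theory.

Local Open Scope classical_set_scope.
Local Open Scope ring_scope.

(** A perspective group is Dedekind finite: if an injective endomorphism [f]
    of [G] has as image a direct summand, say [G = f(G) (+) K], then [G (+) 0]
    and [f(G) (+) K] are decompositions with isomorphic first terms, and the
    common complement can only be [0], so [f(G) = G] and [K = 0]
    ([perspective_dedekind_finite]). It remains to give every infinite bounded
    [p]-group [G] such an endomorphism with [K] nonzero.

    There is a [k] with [p^(k+1) G] finite while the elements killed by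
    [p^(k+1)] have infinitely many multiples by [p^k] ([infinite_ulm_index]).
    Every finitely generated subgroup of [G] being finite, a greedy choice
    yields a sequence [y] of elements killed by [p^(k+1)] such that the
    [p^k y_n] are linearly independent modulo [p^(k+1) G]
    ([exists_independent]). The [y_n] then generate a free module [A] over the
    integers modulo [p^(k+1)] ([comb_eq0]) which meets [p^(k+1) G] trivially,
    and any such [A] is a direct summand of [G] ([homogeneous_summand]): a
    subgroup [H] that contains [p^(k+1) G] and is maximal among those meeting
    [A] trivially is a complement.

    The shift [y_n |-> y_(n+1)] on [A], extended by the identity of [H], is
    the required endomorphism: its image has the nonzero cyclic group
    generated by [y_0] as complement ([shift_endomorphism]).

    Integer combinations of the [y_n] are indexed by integer polynomials, so
    that the shift becomes multiplication by ['X]. *)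

(** * Subgroups and direct sums *)

Lemma mulrzMn (G : zmodType) (x : G) (c : int) (n : nat) :
  x *~ (c * n) = x *+ n *~ c.
Proof. by rewrite mulrC mulrzA -pmulrn. Qed.

Lemma mulrznAC (G : zmodType) (x : G) (c : int) (n : nat) :
  x *~ c *+ n = x *+ n *~ c.
Proof. by rewrite -mulrzMn mulrzA -pmulrn. Qed.

Lemma subgroupP (G : zmodType) (A : set G) :
  subgroup A <-> A 0 /\ (forall x y, A x -> A y -> A (x - y)).
Proof.
split=> -[A0 AB]; split.
- by move: A0; rewrite in_setE.
- by move=> x y Ax Ay; have := AB x y; rewrite !in_setE; apply.
- by rewrite in_setE.
- by move=> x y; rewrite !in_setE; apply: AB.
Qed.

Section SubgroupClosure.
Variables (G : zmodType) (A : set G).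
Hypothesis sA : subgroup A.

Lemma subgroup0 : A 0.
Proof. by have /subgroupP[] := sA. Qed.

Lemma subgroupB x y : A x -> A y -> A (x - y).
Proof. by have /subgroupP[_] := sA; apply. Qed.

Lemma subgroupN x : A x -> A (- x).
Proof.
by move=> Ax; rewrite -[- x]sub0r; apply: subgroupB => //; apply: subgroup0.
Qed.

Lemma subgroupD x y : A x -> A y -> A (x + y).
Proof.
by move=> Ax Ay; rewrite -[y]opprK; apply: subgroupB => //; apply: subgroupN.
Qed.

Lemma subgroupMn x n : A x -> A (x *+ n).
Proof.
move=> Ax; elim: n => [|n IHn]; first exact: subgroup0.
by rewrite mulrS; apply: subgroupD.
Qed.

Lemma subgroupMz x (c : int) : A x -> A (x *~ c).
Proof.
move=> Ax; case: c => n; first exact: subgroupMn.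
by rewrite NegzE mulrNz; apply: subgroupN; apply: subgroupMn.
Qed.

End SubgroupClosure.

Lemma subgroup_range (G H : zmodType) (f : {additive G -> H}) :
  subgroup (range f).
Proof.
apply/subgroupP; split; first by exists 0; rewrite ?raddf0.
by move=> _ _ [x _ <-] [y _ <-]; exists (x - y); rewrite ?raddfB.
Qed.

Lemma subgroup_mulrn (G : zmodType) q : subgroup (range (fun x : G => x *+ q)).
Proof.
apply/subgroupP; split; first by exists 0; rewrite ?mul0rn.
by move=> _ _ [x _ <-] [y _ <-]; exists (x - y); rewrite ?mulrnBl.
Qed.

Lemma subgroup_add (G : zmodType) (A B : set G) :
  subgroup A -> subgroup B -> subgroup [set a + b | a in A & b in B].
Proof.
move=> sA sB; apply/subgroupP; split.
  by exists 0; [exact: subgroup0|exists 0; [exact: subgroup0|rewrite addr0]].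
move=> _ _ [a Aa [b Bb <-]] [a' Aa' [b' Bb' <-]].
exists (a - a'); first exact: subgroupB.
by exists (b - b'); [exact: subgroupB|rewrite opprD addrACA].
Qed.

Lemma direct_sumP (G : zmodType) (A H : set G) :
    subgroup A -> subgroup H -> (forall x, A x -> H x -> x = 0) ->
    (forall g, exists2 a, A a & exists2 h, H h & g = a + h) ->
  direct_sum A H.
Proof.
move=> sA sH AH0 AHT; split=> //; apply/seteqP; split=> //.
- by move=> x [Ax Hx]; apply: AH0.
- by move=> _ ->; split; apply: subgroup0.
- by move=> g _; have [a Aa [h Hh ->]] := AHT g; exists a => //; exists h.
Qed.

(** * Perspective groups are Dedekind finite *)

Lemma perspective_dedekind_finite (G : zmodType) (f : {additive G -> G}) K :
  perspective G -> injective f -> direct_sum (range f) K -> K = [set 0].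
Proof.
move=> Gp finj dK; have [_ sK fK0 _] := dK.
have sT : subgroup [set: G] by apply/subgroupP.
have s0 : subgroup [set (0 : G)].
  by apply/subgroupP; split=> // x y -> ->; rewrite /= subr0.
have d0 : direct_sum [set: G] [set 0].
  by apply: direct_sumP => // g; exists g => //; exists 0; rewrite ?addr0.
have [|C [[_ _ TC0 _] [_ _ _ fCT]]] := Gp _ _ _ _ d0 dK.
  exists f; split; first by move=> x y _ _; rewrite raddfD.
  split; [by move=> x _; exists x | by move=> x y _ _; apply: finj | by []].
apply/seteqP; split=> [x Kx|_ ->]; last exact: subgroup0.
have : [set a + c | a in range f & c in C] x by rewrite fCT.
move=> [a fa [c Cc xE]].
have c0 : c = 0 by have : ([set: G] `&` C) c by []; rewrite TC0.
by rewrite -[[set 0]]fK0; split=> //; rewrite -xE c0 addr0.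
Qed.

(** * Direct summands *)

Lemma maximal_subgroup_avoiding (G : zmodType) (A N : set G) :
    subgroup N -> A `&` N `<=` [set 0] ->
  exists H, [/\ subgroup H, N `<=` H, A `&` H `<=` [set 0] &
    forall H', subgroup H' -> H `<=` H' -> A `&` H' `<=` [set 0] -> H' `<=` H].
Proof.
move=> sN AN0.
pose good X := [/\ subgroup X, N `<=` X & A `&` X `<=` [set 0]].
(* The union of the empty chain is empty, hence not a subgroup: admitting
   [set0] repairs this, and [set0] is not maximal because [N] contains it. *)
have [F FP Ftot|H [HP Hmax]] := @Zorn_bigcup G (fun X => X = set0 \/ good X).
  have [[X0 [FX0 gX0]]|noX] := pselect (exists X, F X /\ good X); last first.
    left; apply/seteqP; split=> // x [X FX Xx].
    by have [X0|gX] := FP _ FX; [rewrite -X0|case: noX; exists X].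
  right; have [sX0 NX0 _] := gX0; split.
  - apply/subgroupP; split; first by exists X0 => //; apply: subgroup0.
    move=> x y [X FX Xx] [Y FY Yy].
    have gP Z z : F Z -> Z z -> good Z.
      by move=> FZ Zz; case: (FP _ FZ) => // Z0; rewrite Z0 in Zz.
    have [XY|YX] := Ftot _ _ FX FY.
    + have [sY _ _] := gP _ _ FY Yy.
      by exists Y => //; apply: subgroupB => //; apply: XY.
    + have [sX _ _] := gP _ _ FX Xx.
      by exists X => //; apply: subgroupB => //; apply: YX.
  - by move=> x Nx; exists X0 => //; apply: NX0.
  - move=> x [Ax [X FX Xx]]; case: (FP _ FX) => [X0E|[_ _]]; last by apply.
    by rewrite X0E in Xx.
have [H0|[sH NH AH0]] := HP.
  case: (Hmax N); last by right; split.
  rewrite H0; split=> // /(_ 0); apply; exact: subgroup0.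
exists H; split=> // H' sH' HH' AH'0; apply: contrapT => nH'H.
by apply: (Hmax H') => //; right; split=> //; apply: subset_trans HH'.
Qed.

Lemma prime_bezout (p : nat) (c : int) : prime p -> ~~ (p %| c)%Z ->
  exists u v : int, u * p + v * c = 1.
Proof.
move=> pp npc; have [u [v uv]] := Bezoutz p c; exists u, v; rewrite uv.
by apply/eqP; rewrite -/(coprimez _ _) coprimezE absz_nat prime_coprime.
Qed.

(** The hypotheses on [A] are those that hold when [A] is a free module over
    the integers modulo [p^(k+1)] and is pure in [G]. Maximality of [H] puts
    in [A + H] any [g] with [p g] in [H], as otherwise [H + <g>] would still
    meet [A] trivially. If only [p g = a + h] is known, then [p^k a] lies in
    [H] together with [p^(k+1) G], so it vanishes and [a = p b] with [b] in
    [A]; the first case applies to [g - b]. Thus [G / (A + H)] has no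
    [p]-torsion, whereas it is a [p]-group. *)
Lemma homogeneous_summand (p k : nat) (G : zmodType) (A : set G) :
    prime p -> abelian_pgroup p G -> subgroup A ->
    A `&` range (fun x => x *+ p ^ k.+1) `<=` [set 0] ->
    (forall a, A a -> a *+ p ^ k = 0 -> exists2 b, A b & a = b *+ p) ->
  exists H, direct_sum A H.
Proof.
move=> pp Gp sA Aq0 Adiv.
have [H [sH qH AH0 Hmax]] := maximal_subgroup_avoiding (subgroup_mulrn _ _) Aq0.
pose AH := [set a + h | a in A & h in H].
have sAH : subgroup AH by apply: subgroup_add.
have HAH x : H x -> AH x.
  by move=> Hx; exists 0; [exact: subgroup0|exists x; rewrite ?add0r].
have AAH x : A x -> AH x.
  by move=> Ax; exists x => //; exists 0; [exact: subgroup0|rewrite addr0].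
have in_AH_of_H g : H (g *+ p) -> AH g.
  move=> Hpg; apply: contrapT => nAHg.
  pose H' := [set h + u | h in H & u in range (fun c : int => g *~ c)].
  have sH' : subgroup H'.
    apply: subgroup_add => //; apply/subgroupP; split; first by exists 0.
    by move=> _ _ [c _ <-] [d _ <-]; exists (c - d) => //; rewrite mulrzBr.
  apply: (nAHg); apply: (HAH); apply: (Hmax H') => //.
  - by move=> h Hh; exists h => //; exists 0; [exists 0|rewrite addr0].
  - move=> x [Ax [h Hh [_ [c _ <-] xE]]].
    have [/dvdzP[d cE]|npc] := boolP (p %| c)%Z.
      apply: AH0; split=> //; rewrite -xE; apply: subgroupD => //.
      by rewrite cE mulrzMn; apply: subgroupMz.
    (* Now [c g] lies in [A + H] with [c] prime to [p], and so does [p g]. *)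
    have [u [v uv1]] := prime_bezout pp npc.
    case: nAHg; rewrite -[g]mulr1z -uv1 mulrzDr; apply: subgroupD => //.
      by apply: HAH; rewrite mulrzMn; apply: subgroupMz.
    rewrite mulrC mulrzA; apply: subgroupMz => //.
    have -> : g *~ c = x - h by rewrite -xE addrC addKr.
    by apply: subgroupB; [|exact: AAH|exact: HAH].
  - by exists 0; [exact: subgroup0|exists g; [exists 1|rewrite add0r]].
have in_AH_of_AH g : AH (g *+ p) -> AH g.
  move=> [a Aa [h Hh pgE]].
  have [|b Ab aE] := Adiv a Aa.
    apply: AH0; split; first exact: subgroupMn.
    have -> : a *+ p ^ k = g *+ p ^ k.+1 - h *+ p ^ k.
      by rewrite expnS mulrnA -pgE mulrnDl addrK.
    by apply: subgroupB => //; [apply: qH; exists g|apply: subgroupMn].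
  have /in_AH_of_H AHgb : H ((g - b) *+ p) by rewrite mulrnBl -aE -pgE addrC addKr.
  by rewrite -[g](subrK b); apply: subgroupD => //; apply: AAH.
exists H; apply: direct_sumP => // [x Ax Hx|g]; first exact: AH0.
suff [a Aa [h Hh <-]] : AH g by exists a => //; exists h.
have [n gn0] := Gp g; elim: n g gn0 => [|n IHn] g gn0.
  by rewrite -[g]mulr1n gn0; apply: subgroup0.
by apply: in_AH_of_AH; apply: IHn; rewrite -mulrnA -expnS.
Qed.

(** * Integer combinations of a sequence *)

Section IntegerCombinations.
Variables (G : zmodType) (y : nat -> G).

Definition comb (P : {poly int}) : G := \sum_(i < size P) y i *~ P`_i.

Lemma combE n (P : {poly int}) : (size P <= n)%N ->
  comb P = \sum_(i < n) y i *~ P`_i.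
Proof.
move=> sPn; rewrite /comb (big_ord_widen n (fun i => y i *~ P`_i)) //.
rewrite [RHS](bigID (fun i : 'I_n => (i < size P)%N)) /= [X in _ + X]big1 ?addr0 //.
by move=> i; rewrite -leqNgt => /(nth_default 0) ->.
Qed.

Lemma comb_is_zmod_morphism : zmod_morphism comb.
Proof.
move=> P Q; have [n [sP sQ sPQ]] : exists n,
    [/\ size P <= n, size Q <= n & size (P - Q)%R <= n]%N.
  exists (maxn (size P) (size Q)); rewrite leq_maxl leq_maxr; split=> //.
  by rewrite -[size Q]size_polyN size_polyD.
rewrite !(@combE n) // -sumrB; apply: eq_bigr => i _.
by rewrite coefB mulrzBr.
Qed.

HB.instance Definition _ := GRing.isZmodMorphism.Build {poly int} G comb
  comb_is_zmod_morphism.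

Lemma combC (c : int) : comb c%:P = y 0%N *~ c.
Proof. by rewrite (@combE 1) ?size_polyC_leq1 // big_ord1 coefC. Qed.

End IntegerCombinations.

(** * Finiteness in bounded groups *)

Lemma finite_extension (G : zmodType) (V : set G) (f : G -> G) :
    {morph f : x z / x - z} -> subgroup V -> finite_set (f @` V) ->
  finite_set (V `&` [set x | f x = 0]) -> finite_set V.
Proof.
move=> fB sV fV kV.
have /choice[s sP] (b : G) : exists x, (f @` V) b -> V x /\ f x = b.
  have [[x Vx fx]|nb] := pselect ((f @` V) b); first by exists x.
  by exists 0.
apply: (@sub_finite_set _ _
  [set s b + z | b in f @` V & z in V `&` [set x | f x = 0]]); last first.
  exact: finite_image2.
move=> x Vx; have fVx : (f @` V) (f x) by exists x.
have [Vs fs] := sP _ fVx.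
exists (f x) => //; exists (x - s (f x)); last by rewrite addrC subrK.
by split; [exact: subgroupB|rewrite /= fB fs subrr].
Qed.

(** The scalars of the combinations can be reduced modulo the exponent [q]. *)
Lemma finite_add_combinations (G : zmodType) q (Z : set G) (y : nat -> G) n :
    (0 < q)%N -> (forall x : G, x *+ q = 0) -> finite_set Z ->
  finite_set [set g | exists2 z, Z z & exists c : nat -> int,
                        g = z + \sum_(i < n) y i *~ c i].
Proof.
move=> q_gt0 Gq fZ; elim: n => [|n IHn].
  apply: sub_finite_set fZ => g [z Zz [c ->]].
  by rewrite big_ord0 addr0.
apply: sub_finite_set (finite_image2 (fun u r => u + y n *+ r) IHn (finite_II q)).
move=> g [z Zz [c ->]].
exists (z + \sum_(i < n) y i *~ c i); first by exists z => //; exists c.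
have r_ge0 : 0 <= (c n %% q)%Z by rewrite modz_ge0 // gt_eqF.
have r_lt : ((c n %% q)%Z < q)%R by rewrite ltz_pmod.
exists `|(c n %% q)%Z|%N; first by rewrite /= -ltz_nat gez0_abs.
rewrite big_ord_recr /= addrA; congr (_ + _).
have -> : y n *~ c n = y n *~ (c n %% q)%Z.
  rewrite {1}(divz_eq (c n) q) mulrzDr.
  by rewrite mulrzMn Gq mul0rz add0r.
by rewrite pmulrn gez0_abs.
Qed.

(** * An infinite independent sequence *)

Lemma greedy_sequence (T : Type) (R : seq T -> T -> Prop) :
    (forall s, exists x, R s x) ->
  exists u : nat -> T, forall n, R (mkseq u n) (u n).
Proof.
move=> /choice[next nextP].
pose pre := fix pre n := if n is m.+1 then rcons (pre m) (next (pre m)) else [::].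
exists (fun n => next (pre n)) => n.
suff -> : mkseq (fun m => next (pre m)) n = pre n by apply: nextP.
by elim: n => [|n IHn] //; rewrite mkseqS IHn.
Qed.

(** Linear independence of the [p^k y_n] modulo [p^(k+1) G], over the field
    with [p] elements, in the triangular form that a greedy choice produces:
    no term is a combination of the earlier ones. *)
Definition independent_mod (G : zmodType) (p k : nat) (y : nat -> G) :=
  (forall n, y n *+ p ^ k.+1 = 0) /\
  (forall n (c : nat -> int) z,
     y n *+ p ^ k <> z *+ p ^ k.+1 + \sum_(i < n) (y i *+ p ^ k) *~ c i).

(** Take [k] with [p^k G] infinite and [p^(k+1) G] finite. Multiplication by
    [p] maps the former onto the latter, so its kernel in [p^k G] is infinite,
    and this kernel is the second set of the conclusion. *)
Lemma infinite_ulm_index (p : nat) (G : zmodType) :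
    bounded_pgroup p G -> infinite_set [set: G] ->
  exists k, finite_set (range (fun x : G => x *+ p ^ k.+1)) /\
    infinite_set [set x *+ p ^ k | x in [set x : G | x *+ p ^ k.+1 = 0]].
Proof.
move=> [_ [n Gn]] iG.
have fn : finite_set (range (fun x : G => x *+ p ^ n)).
  by apply: (@sub_finite_set _ _ [set 0]) => // _ [x _ <-] /=.
have [k [fk1 ifk]] : exists k, finite_set (range (fun x : G => x *+ p ^ k.+1)) /\
    infinite_set (range (fun x : G => x *+ p ^ k)).
  elim: n {Gn} fn => [|n IHn] fn.
    case: iG; apply: sub_finite_set fn => x _; by exists x; rewrite ?mulr1n.
  have [/IHn//|infn] := pselect (finite_set (range (fun x : G => x *+ p ^ n))).
  by exists n.
exists k; split=> // fU; apply: ifk.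
apply: (@finite_extension _ _ (fun x => x *+ p)).
- by move=> x z; rewrite mulrnBl.
- exact: subgroup_mulrn.
- apply: sub_finite_set fk1 => _ [_ [x _ <-] <-].
  by exists x => //; rewrite expnSr mulrnA.
- apply: sub_finite_set fU => _ [[x _ <-] /= xp].
  by exists x => //=; rewrite expnSr mulrnA.
Qed.

(** If no next term existed, all [p^k x] with [p^(k+1) x = 0] would lie in the
    sum of the finite group [p^(k+1) G] and a finitely generated one. *)
Lemma exists_independent (p : nat) (G : zmodType) : prime p ->
    bounded_pgroup p G -> infinite_set [set: G] ->
  exists k y, @independent_mod G p k y.
Proof.
move=> pp bG iG; have [k [fk iU]] := infinite_ulm_index bG iG; exists k.
have [_ [N GN]] := bG.
have [s|y yP] := @greedy_sequence G (fun s y => y *+ p ^ k.+1 = 0 /\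
    forall (c : nat -> int) z,
      y *+ p ^ k <> z *+ p ^ k.+1 + \sum_(i < size s) (s`_i *+ p ^ k) *~ c i).
  apply: contrapT => nex; apply: iU.
  have pN_gt0 : (0 < p ^ N)%N by rewrite expn_gt0 prime_gt0.
  apply: sub_finite_set (finite_add_combinations
    (fun i => s`_i *+ p ^ k) (size s) pN_gt0 GN fk).
  move=> _ [x xq <-]; apply: contrapT => nx; apply: nex; exists x; split=> // c z xE.
  by apply: nx; exists (z *+ p ^ k.+1); [exists z|exists c].
exists y; split=> [n|n c z yE]; first by case: (yP n).
have [_ /(_ c z)] := yP n; apply; rewrite yE size_mkseq; congr (_ + _).
by apply: eq_bigr => i _; rewrite nth_mkseq.
Qed.

(** * The summand generated by an independent sequence *)

Section Independent.
Variables (G : zmodType) (p k : nat) (y : nat -> G).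
Hypotheses (pp : prime p) (yP : independent_mod p k y).
Let pG q := range (fun x : G => x *+ q).

Lemma comb_order P : comb y P *+ p ^ k.+1 = 0.
Proof.
rewrite -sumrMnl big1 // => i _.
by rewrite mulrznAC yP.1 mul0rz.
Qed.

(** Induction on the number of coefficients. When the top one, at index [n],
    is divisible by [p], its term vanishes after multiplication by [p^k] and
    can be dropped; otherwise, inverting it modulo [p] would express [p^k y_n]
    by the earlier [p^k y_i] modulo [p^(k+1) G]. *)
Lemma comb_div_p P : pG (p ^ k.+1) (comb y P *+ p ^ k) ->
  exists Q, P = Q *+ p.
Proof.
have [n sPn] : exists n, (size P <= n)%N by exists (size P).
elim: n P sPn => [|n IHn] P sPn Pdiv.
  by exists 0; rewrite mul0rn; apply/eqP; rewrite -size_poly_eq0 -leqn0.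
have sP' : (size (P - P`_n *: 'X^n)%R <= n)%N.
  apply/leq_sizeP => j; rewrite coefB coefZ coefXn leq_eqVlt => /orP[/eqP<-|nj].
    by rewrite eqxx mulr1 subrr.
  by rewrite (gtn_eqF nj) mulr0 subr0 nth_default // (leq_trans sPn).
have combX (c : int) : comb y (c *: 'X^n) = y n *~ c.
  rewrite (@combE _ _ n.+1); last first.
    by rewrite (leq_trans (size_scale_leq _ _)) ?size_polyXn.
  rewrite big_ord_recr /= coefZ coefXn eqxx mulr1 big1 ?add0r // => i _.
  by rewrite coefZ coefXn (ltn_eqF (ltn_ord i)) mulr0 mulr0z.
have [/dvdzP[d dE]|npc] := boolP (p %| P`_n)%Z.
  have [|Q QE] := IHn _ sP'.
    have -> : comb y (P - P`_n *: 'X^n) *+ p ^ k = comb y P *+ p ^ k.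
      rewrite raddfB /= combX mulrnBl dE mulrzMn mulrznAC -mulrnA -expnS.
      by rewrite yP.1 mul0rz subr0.
    exact: Pdiv.
  exists (Q + d *: 'X^n).
  rewrite mulrnDl -QE -scaler_nat scalerA [_ * d]mulrC natz -dE.
  by rewrite subrK.
have [u [v uv1]] := prime_bezout pp npc.
have [z _ zE] := Pdiv.
have PE : comb y P = \sum_(i < n) y i *~ P`_i + y n *~ P`_n.
  by rewrite (combE _ sPn) big_ord_recr.
case: (yP.2 n (fun i => - (P`_i * v)) (z *~ v)).
have -> : y n *+ p ^ k = (y n *~ P`_n *+ p ^ k) *~ v.
  rewrite -{1}[y n]mulr1z -uv1 mulrzDr mulrnDl mulrzMn !mulrznAC.
  by rewrite -mulrnA -expnS yP.1 mul0rz add0r [v * _]mulrC mulrzA.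
have -> : y n *~ P`_n = comb y P - \sum_(i < n) y i *~ P`_i.
  by rewrite PE addrC addKr.
rewrite mulrnBl -zE mulrzBl mulrznAC; congr (_ + _).
rewrite -sumrMnl -mulNrz -sumrN mulrz_suml; apply: eq_bigr => i _.
by rewrite mulrznAC mulNrz mulrNz mulrzA.
Qed.

(** Powers of [p] are extracted from [P] one at a time: if [P = p^j Q] with
    [j <= k], multiplying the hypothesis by [p^(k-j)] makes [comb_div_p] apply
    to [Q]. *)
Lemma comb_div_q P : pG (p ^ k.+1) (comb y P) -> exists Q, P = Q *+ p ^ k.+1.
Proof.
move=> Pdiv; suff H j : (j <= k.+1)%N -> exists Q, P = Q *+ p ^ j by apply: H.
elim: j => [_|j IHj jk]; first by exists P.
have [Q QE] := IHj (ltnW jk).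
have [|Q' Q'E] := @comb_div_p Q; last by exists Q'; rewrite QE Q'E -mulrnA -expnS.
have -> : comb y Q *+ p ^ k = comb y P *+ p ^ (k - j).
  by rewrite QE raddfMn -mulrnA -expnD subnKC.
by apply: subgroupMn => //; apply: subgroup_mulrn.
Qed.

Lemma comb_eq0 P : comb y P = 0 <-> exists Q, P = Q *+ p ^ k.+1.
Proof.
split=> [P0|[Q ->]]; last by rewrite raddfMn comb_order.
by apply: comb_div_q; exists 0 => //; rewrite mul0rn P0.
Qed.

Lemma comb_eq0_shift P : comb y (P * 'X) = 0 <-> comb y P = 0.
Proof.
rewrite !comb_eq0; split=> -[Q QE]; last by exists (Q * 'X); rewrite QE mulrnAl.
exists (drop_poly 1 Q); apply/polyP => i.
by rewrite coefMn coef_drop_poly addn1 -coefMn -QE coefMX.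
Qed.

Lemma comb_summand : abelian_pgroup p G -> exists H, direct_sum (range (comb y)) H.
Proof.
move=> Gp; apply: (homogeneous_summand pp Gp (k := k)).
- exact: subgroup_range.
- move=> _ [[P _ <-] /comb_div_q[Q ->]].
  by rewrite /= raddfMn comb_order.
- move=> _ [P _ <-] P0; have [|Q ->] := @comb_div_p P.
    by rewrite P0; exists 0; rewrite ?mul0rn.
  by exists (comb y Q); [exists Q|rewrite raddfMn].
Qed.

(** [f] maps [comb P + h] to [comb (P * 'X) + h]; it is well defined and
    injective because [comb (P * 'X)] vanishes exactly when [comb P] does. In
    the sum of its image and the multiples of [y 0], the latter account for
    the constant coefficients. *)
Lemma shift_endomorphism H : direct_sum (range (comb y)) H ->
  exists f : {additive G -> G},
    injective f /\ direct_sum (range f) (range (comb y \o polyC)).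
Proof.
move=> [sA sH AH0 AHT].
have uniq_dec P P' h h' : H h -> H h' ->
    comb y P + h = comb y P' + h' -> comb y P = comb y P' /\ h = h'.
  move=> Hh Hh' E.
  have E' : comb y P - comb y P' = h' - h.
    by apply/eqP; rewrite subr_eq addrAC [h' + _]addrC -E addrK.
  have : (range (comb y) `&` H) (comb y P - comb y P').
    by split; [exists (P - P'); rewrite ?raddfB|rewrite E'; apply: subgroupB].
  rewrite AH0 => PP'; split; first exact/subr0_eq.
  by apply/esym/subr0_eq; rewrite -E'.
have /choice[d dP] (g : G) :
    exists Ph : {poly int} * G, H Ph.2 /\ g = comb y Ph.1 + Ph.2.
  have : [set a + h | a in range (comb y) & h in H] g by rewrite AHT.
  by move=> [_ [P _ <-] [h Hh <-]]; exists (P, h).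
pose f g := comb y ((d g).1 * 'X) + (d g).2.
have fE P h : H h -> f (comb y P + h) = comb y (P * 'X) + h.
  move=> Hh; rewrite /f; have [Hd dE] := dP (comb y P + h).
  have [//|//|Pd <-] := uniq_dec _ _ _ _ _ _ dE.
  congr (_ + _); apply/subr0_eq; rewrite -raddfB -mulrBl; apply/comb_eq0_shift.
  by rewrite raddfB /= -Pd subrr.
have fB : zmod_morphism f.
  move=> g g'; have [Hh gE] := dP g; have [Hh' gE'] := dP g'.
  rewrite {1}gE {1}gE' opprD addrACA -raddfB fE; last exact: subgroupB.
  by rewrite mulrBl raddfB -addrACA -opprD.
pose F : {additive G -> G} := HB.pack f (GRing.isZmodMorphism.Build G G f fB).
exists F; split.
  apply: raddf_inj => g /=; have [Hh ->] := dP g; rewrite fE // => g0.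
  have g0' : comb y ((d g).1 * 'X) + (d g).2 = comb y 0 + 0.
    by rewrite g0 raddf0 addr0.
  have [//||Pd0 ->] := uniq_dec _ _ _ _ _ _ g0'; first exact: subgroup0.
  by rewrite raddf0 in Pd0; have /comb_eq0_shift -> := Pd0; rewrite addr0.
have FE P h : H h -> range F (comb y (P * 'X) + h).
  by move=> Hh; exists (comb y P + h) => //; apply: fE.
apply: direct_sumP; try exact: subgroup_range.
- move=> _ [g _ <-] [c _ /= fg0]; have [Hh gE] := dP g.
  have : comb y c%:P + 0 = comb y ((d g).1 * 'X) + (d g).2 by rewrite addr0.
  move=> /uniq_dec[||cE _] //; first exact: subgroup0.
  (* Comparing constant coefficients shows that [c] a multiple of
     [p^(k+1)], which kills [y 0]. *)
  have /comb_eq0[Q QE] : comb y (c%:P - (d g).1 * 'X) = 0.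
    by rewrite raddfB /= cE subrr.
  have cE0 : c = Q`_0 *+ p ^ k.+1.
    by rewrite -coefMn -QE coefB coefC coefMX subr0.
  by rewrite -fg0 cE0 polyCMn raddfMn comb_order.
- move=> g; have [Hh ->] := dP g; elim/poly_ind: (d g).1 => [|P c _].
    exists (comb y (0 * 'X) + (d g).2); first exact: FE.
    exists 0; first by exists 0; rewrite //= raddf0.
    by rewrite mul0r addr0.
  exists (comb y (P * 'X) + (d g).2); first exact: FE.
  by exists (comb y c%:P); [exists c|rewrite raddfD addrAC].
Qed.

End Independent.

Theorem corollary3p9 (p : nat) (hp : prime p) (G : zmodType)
    (hbounded : bounded_pgroup p G) (hpersp : perspective G) :
  finite_set [set: G].
Proof.
apply: contrapT => iG.
have [k [y yP]] := exists_independent hp hbounded iG.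
have [H dH] := comb_summand hp yP hbounded.1.
have [f [finj df]] := shift_endomorphism hp yP dH.
have K0 := perspective_dedekind_finite hpersp finj df.
have y00 : y 0%N = 0.
  have : range (comb y \o polyC) (y 0%N) by exists 1; rewrite //= combC.
  by rewrite K0.
by apply: (yP.2 0%N (fun=> 0) 0); rewrite y00 !mul0rn big_ord0 addr0.
Qed.
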